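(* Let $p$ be an odd prime, let $q\in\mathbb{C}_p$ with $|1-q|_p<p^{-\frac{1}{p-1}}$, and let $x\in\mathbb{Z}_p$. For every integer $n\geq 0$, \[ Ch_{n,q}(x)=[2]_q\sum_{k=0}^n\sum_{l=0}^k\frac{1}{(1-q)^k}\binom{k}{l}q^{lx}(-1)^l\frac{S_1(n,k)}{1+q^{l+1}}=\sum_{k=0}^n S_1(n,k)\,\mathcal{E}_{k,q}(x). \]
   Context: $\mathbb{Z}_p$, $\mathbb{C}_p$ denote the $p$-adic integers and the completion of an algebraic closure of $\mathbb{Q}_p$, with $|p|_p=1/p$. For $x\in\mathbb{Z}_p$, $[x]_q=\frac{q^x-1}{q-1}$; in particular $[2]_q=1+q$. The fermionic $p$-adic $q$-integral of a continuous $f:\mathbb{Z}_p\to\mathbb{C}_p$ is $\int_{\mathbb{Z}_p}f(y)\,d\mu_{-q}(y)=\lim_{N\to\infty}\frac{1}{[p^N]_{-q}}\sum_{y=0}^{p^N-1}f(y)(-q)^y$, where $[m]_{-q}=\frac{1-(-q)^m}{1+q}$. The Carlitz $q$-Euler polynomials are $\mathcal{E}_{n,q}(x)=\int_{\mathbb{Z}_p}[x+y]_q^n\,d\mu_{-q}(y)$. The Carlitz-type $q$-Changhee polynomials $Ch_{n,q}(x)$ are defined by $\int_{\mathbb{Z}_p}(1+t)^{[x+y]_q}\,d\mu_{-q}(y)=\sum_{n\ge0}Ch_{n,q}(x)\frac{t^n}{n!}$ for $t\in\mathbb{C}_p$ with $|t|_p<p^{-\frac{1}{p-1}}$. $S_1(n,k)$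 are the (signed) Stirling numbers of the first kind, $x(x-1)\cdots(x-n+1)=\sum_{k=0}^nS_1(n,k)x^k$. *)

(* Defs.v *)
From HB Require Import structures.
From mathcomp Require Import all_boot all_order all_algebra.
From mathcomp Require Import all_classical all_reals all_analysis.

Set Implicit Arguments.
Unset Strict Implicit.
Unset Printing Implicit Defensive.

Import Order.TTheory GRing.Theory Num.Theory.
Import numFieldNormedType.Exports.

Local Open Scope classical_set_scope.
Local Open Scope ring_scope.

(* The field [K] comes with a real-valued ultrametric absolute value [v].
   MathComp norms satisfy [`|x *+ n| = `|x| *+ n], which fails p-adically, so
   convergence is expressed through the real sequence [v (u n - l)]. *)
Definition vcvg (R : realType) (K : fieldType) (v : K -> R)
    (u : nat -> K) (l : K) : Prop :=
  v (u n - l) @[n --> \oo] --> (0 : R).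

Definition vcauchy (R : realType) (K : fieldType) (v : K -> R)
    (u : nat -> K) : Prop :=
  forall e : R, 0 < e ->
    exists N : nat, forall m n : nat,
      (N <= m)%N -> (N <= n)%N -> v (u m - u n) < e.

Definition vclosure (R : realType) (K : fieldType) (v : K -> R)
    (A : set K) : set K :=
  [set x | forall e : R, 0 < e -> exists2 y, A y & v (x - y) < e].

(* In a complete field where [v] restricts to the p-adic absolute value of the
   rationals, the closure of the rationals is Q_p and the closure of the
   integers is Z_p. *)
Definition padic_num (R : realType) (K : fieldType) (v : K -> R) : set K :=
  vclosure v (range (fun r : rat => ratr r : K)).

Definition padic_int (R : realType) (K : fieldType) (v : K -> R) : set K :=
  vclosure v (range (fun m : int => m%:~R : K)).

Definition Qpbar (R : realType) (K : fieldType) (v : K -> R) : set K :=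
  [set x | exists P : {poly K},
     [/\ P != 0, forall i : nat, padic_num v P`_i & root P x]].

(* [(K, v)] is C_p: [K] is complete for an ultrametric absolute value with
   |p| = 1/p, its elements algebraic over Q_p form an algebraically closed
   field (hence an algebraic closure of Q_p), and these are dense.  This
   determines [(K, v)] up to isometric isomorphism. *)
Record is_Cp (R : realType) (p : nat) (K : fieldType) (v : K -> R) : Prop :=
  IsCp {
    Cp_abs_ge0 : forall x, 0 <= v x;
    Cp_abs_eq0 : forall x, v x = 0 <-> x = 0;
    Cp_absM : forall x y, v (x * y) = v x * v y;
    Cp_absD : forall x y, v (x + y) <= Num.max (v x) (v y);
    Cp_abs_p : v p%:R = p%:R^-1;
    Cp_complete : forall u, vcauchy v u -> exists l, vcvg v u l;
    Cp_Qpbar_closed : forall P : {poly K},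
      (1 < size P)%N -> (forall i : nat, Qpbar v P`_i) ->
      exists2 x, Qpbar v x & root P x;
    Cp_Qpbar_dense : vclosure v (Qpbar v) = setT }.

(* Equal to 0 when the limit does not exist. *)
Definition vlim (R : realType) (K : fieldType) (v : K -> R)
    (u : nat -> K) : K :=
  xget 0 [set l | vcvg v u l].

Definition vseries (R : realType) (K : fieldType) (v : K -> R)
    (a : nat -> K) : K :=
  vlim v (fun N => \sum_(0 <= n < N) a n).

(* The radius p^(-1/(p-1)) of convergence of the p-adic exponential. *)
Definition exp_radius (R : realType) (p : nat) : R :=
  p%:R `^ (- (p.-1)%:R^-1).

Definition padic_exp (R : realType) (K : fieldType) (v : K -> R) (z : K) : K :=
  vseries v (fun n => z ^+ n / n`!%:R).

(* The term of index [n] is the term of degree [n.+1] of log (1 + (a - 1)). *)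
Definition padic_log (R : realType) (K : fieldType) (v : K -> R) (a : K) : K :=
  vseries v (fun n => (-1) ^+ n * (a - 1) ^+ n.+1 / n.+1%:R).

(* a^z for |a - 1| < p^(-1/(p-1)) and |z| <= 1. *)
Definition padic_pow (R : realType) (K : fieldType) (v : K -> R)
    (a z : K) : K :=
  padic_exp v (z * padic_log v a).

Definition qnumber (R : realType) (K : fieldType) (v : K -> R) (q x : K) : K :=
  (padic_pow v q x - 1) / (q - 1).

Definition qnumber_neg (K : fieldType) (q : K) (m : nat) : K :=
  (1 - (- q) ^+ m) / (1 + q).

(* Only the values of [f] at the natural numbers, which lie in Z_p, matter. *)
Definition fermionic_integral (R : realType) (p : nat) (K : fieldType)
    (v : K -> R) (q : K) (f : K -> K) : K :=
  vlim v (fun N =>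
    (qnumber_neg q (p ^ N)%N)^-1 *
    \sum_(0 <= y < (p ^ N)%N) f y%:R * (- q) ^+ y).

Definition q_Euler (R : realType) (p : nat) (K : fieldType) (v : K -> R)
    (q : K) (n : nat) (x : K) : K :=
  fermionic_integral p v q (fun y => qnumber v q (x + y) ^+ n).

Definition is_q_Changhee (R : realType) (p : nat) (K : fieldType)
    (v : K -> R) (q x : K) (c : nat -> K) : Prop :=
  forall t : K, v t < exp_radius R p ->
    vcvg v (fun N => \sum_(0 <= n < N) c n * t ^+ n / n`!%:R)
      (fermionic_integral p v q
         (fun y => padic_pow v (1 + t) (qnumber v q (x + y)))).

(* The coefficient sequence of the generating function; zero if there is none. *)
Definition q_Changhee (R : realType) (p : nat) (K : fieldType)
    (v : K -> R) (q : K) (n : nat) (x : K) : K :=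
  xget (fun _ => 0) [set c | is_q_Changhee p v q x c] n.

Definition stirling1 (n k : nat) : int :=
  (\prod_(0 <= i < n) ('X - (i%:Z)%:P))`_k.

(* Main.v *)
(* For |z| <= 1 and |a - 1| < r = p^(-1/(p-1)), the functions exp (z log a) and
   \sum_n binom(z, n) (a - 1)^n of [z] both turn sums into products (Cauchy
   product) and agree to first order at [z = 0]; comparing them at [p^j z] and
   taking [p^j]-th roots shows that they coincide.  Hence a^z is given by the
   binomial series even when [z] is only in the unit disk of C_p, as is the case
   for z = [x + y]_q.  The fermionic sums of y |-> q^(l y) are geometric, and
   their limits give the q-Euler polynomials after expanding [x + y]_q^k.
   Since the fermionic sums are bounded by the sup norm and the binomial series
   converges uniformly in [z], (1 + t)^[x + y]_q can be integrated termwise; the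
   falling factorials integrate to \sum_k S_1(n, k) E_k(x), and a power series
   determines its coefficients. *)
Require Import Defs.
From HB Require Import structures.
From mathcomp Require Import all_boot all_order all_algebra.
From mathcomp Require Import all_classical all_reals all_analysis.
From mathcomp Require Import ring zify.

Import Order.TTheory GRing.Theory Num.Theory.
Import numFieldNormedType.Exports.

Local Open Scope classical_set_scope.
Local Open Scope ring_scope.

Section Cp.
Context {R : realType} {p : nat} {K : fieldType} {v : K -> R}.
Hypotheses (p_prime : prime p) (HK : is_Cp p v).

Let v_ge0 := Cp_abs_ge0 HK.
Let vM := Cp_absM HK.
Local Notation r := (exp_radius R p).
Local Notation pi := (p%:R^-1 : R).

(** * Ultrametric absolute values *)

Lemma abs0 : v 0 = 0.
Proof. exact/(Cp_abs_eq0 HK). Qed.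

Lemma abs_eq0 x : (v x == 0) = (x == 0).
Proof. by apply/eqP/eqP; apply (Cp_abs_eq0 HK). Qed.

Lemma abs_gt0 x : (0 < v x) = (x != 0).
Proof. by rewrite lt_def abs_eq0 v_ge0 andbT. Qed.

Lemma abs1 : v 1 = 1.
Proof.
have v1_neq0 : v 1 != 0 by rewrite abs_eq0 oner_eq0.
by apply: (mulfI v1_neq0); rewrite -vM !mulr1.
Qed.

Lemma absX x n : v (x ^+ n) = v x ^+ n.
Proof. by elim: n => [|n IHn]; rewrite ?expr0 ?abs1 // !exprS vM IHn. Qed.

Lemma absV x : v x^-1 = (v x)^-1.
Proof.
have [->|x_neq0] := eqVneq x 0; first by rewrite invr0 abs0 invr0.
have vx_neq0 : v x != 0 by rewrite abs_eq0.
by apply: (mulfI vx_neq0); rewrite -vM !divff // abs1.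
Qed.

Lemma absN x : v (- x) = v x.
Proof.
suff vN1 : v (-1) = 1 by rewrite -mulN1r vM vN1 mul1r.
apply/eqP; rewrite -(@eqrXn2 _ 2) ?ler01 //.
by rewrite -absX sqrrN expr1n abs1 expr1n.
Qed.

Lemma abs_sub x y : v (x - y) = v (y - x).
Proof. by rewrite -opprB absN. Qed.

Lemma abs_addr_le x y C : v x <= C -> v y <= C -> v (x + y) <= C.
Proof.
by move=> xC yC; apply: le_trans (Cp_absD HK x y) _; rewrite ge_max xC.
Qed.

Lemma abs_subr_le x y C : v x <= C -> v y <= C -> v (x - y) <= C.
Proof. by move=> xC yC; apply: abs_addr_le; rewrite // absN. Qed.

Lemma abs_addr_lt x y C : v x < C -> v y < C -> v (x + y) < C.
Proof.
by move=> xC yC; apply: le_lt_trans (Cp_absD HK x y) _; rewrite gt_max xC.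
Qed.

Lemma abs_sum_le (I : eqType) (s : seq I) (P : pred I) (F : I -> K) C :
  0 <= C -> (forall i, i \in s -> P i -> v (F i) <= C) ->
  v (\sum_(i <- s | P i) F i) <= C.
Proof.
move=> C_ge0 FC; rewrite big_seq_cond.
apply: (big_ind (fun x => v x <= C)) => [|x y|i /andP[]].
- by rewrite abs0.
- exact: abs_addr_le.
- exact: FC.
Qed.

Lemma abs_nat_le1 m : v m%:R <= 1.
Proof.
elim: m => [|m IHm]; first by rewrite abs0.
by rewrite -natr1; apply: abs_addr_le; rewrite ?abs1.
Qed.

Lemma abs_int_le1 (m : int) : v m%:~R <= 1.
Proof.
by case: m => m; rewrite ?NegzE ?mulrNz ?absN; apply: abs_nat_le1.
Qed.

(** Otherwise [x = (x + y) - y] would be a difference of two elements both strictly smaller than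
    [x]. *)
Lemma abs_dominant x y : v y < v x -> v (x + y) = v x.
Proof.
move=> yx; apply/eqP; rewrite eq_le; apply/andP; split.
  exact: abs_addr_le (ltW yx).
rewrite leNgt; apply/negP => xy_lt.
suff: v x < v x by rewrite ltxx.
by rewrite -{1}(addrK y x); apply: abs_addr_lt; rewrite ?absN.
Qed.

Lemma abs_near1 x : v (x - 1) < 1 -> v x = 1.
Proof.
by move=> x1; rewrite -(subrKC 1 x) abs_dominant abs1.
Qed.

(** * Absolute values of integers and factorials, and the exponential radius *)

Lemma ratio_p_gt0 : 0 < pi.
Proof. by rewrite invr_gt0 ltr0n prime_gt0. Qed.

Lemma ratio_p_lt1 : pi < 1.
Proof. by rewrite invf_lt1 ?ltr1n ?ltr0n ?prime_gt1 ?prime_gt0. Qed.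

(** Bezout gives [a * m = b * p + 1], so [a * m] is within 1/p of 1 and has absolute value 1; as
    both factors have absolute value at most 1, neither can be smaller. *)
Lemma abs_coprime m : coprime p m -> v m%:R = 1.
Proof.
move=> pm; have m_gt0 : (0 < m)%N.
  by case: m pm p_prime => //; rewrite /coprime gcdn0 => /eqP ->.
have [a b abE _] := egcdnP p m_gt0.
have : v (a * m)%:R = 1.
  apply: abs_near1; rewrite abE gcdnC (eqP pm) natrD addrK natrM vM.
  rewrite (Cp_abs_p HK); apply: le_lt_trans ratio_p_lt1.
  by rewrite ler_piMl ?abs_nat_le1 // ltW // ratio_p_gt0.
rewrite natrM vM => am1; apply/eqP; rewrite eq_le abs_nat_le1 /= -am1.
by rewrite ler_piMl ?abs_nat_le1.
Qed.

Lemma abs_nat m : (0 < m)%N -> v m%:R = pi ^+ logn p m.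
Proof.
move=> m_gt0; have [m' pm' {1}->] := pfactor_coprime p_prime m_gt0.
by rewrite natrM vM abs_coprime // mul1r natrX absX (Cp_abs_p HK).
Qed.

Lemma radius_gt0 : 0 < r.
Proof. by apply: powR_gt0; rewrite ltr0n prime_gt0. Qed.

Lemma radius_exp : r ^+ p.-1 = pi.
Proof.
rewrite -powR_mulrn ?ltW ?radius_gt0 // -powRrM mulNr mulVf.
  by rewrite powR_inv1 // ler0n.
by rewrite pnatr_eq0 -lt0n -subn1 subn_gt0 prime_gt1.
Qed.

Lemma radius_lt1 : r < 1.
Proof.
have p1_gt0 : (0 < p.-1)%N by rewrite -subn1 subn_gt0 prime_gt1.
by rewrite -(expr_lt1 p1_gt0) ?ltW ?radius_gt0 // radius_exp ratio_p_lt1.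
Qed.

(* Legendre's formula, with the digit sum of [n] bounded below by 1: each
   [n %/ p ^ k] is at least [p] times the next one, so the sum telescopes. *)
Lemma logn_fact_le n : (p.-1 * logn p n.+1`! <= n)%N.
Proof.
rewrite logn_fact //.
have -> : (\sum_(1 <= k < n.+2) n.+1 %/ p ^ k
           = \sum_(0 <= k < n.+1) n.+1 %/ p ^ k.+1)%N by rewrite big_add1.
suff claim m : (p.-1 * (\sum_(0 <= k < m) n.+1 %/ p ^ k.+1)
    + maxn 1 (n.+1 %/ p ^ m) <= n.+1)%N.
  by move: (claim n.+1) (leq_maxl 1 (n.+1 %/ p ^ n.+1)); lia.
elim: m => [|m]; first by rewrite big_geq // muln0 expn0 divn1 geq_max leqnn.
rewrite big_nat_recr //= expnSr divnMA.
set a := (n.+1 %/ p ^ m)%N; set S := (\sum_(_ <= _ < _) _)%N.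
have := leq_trunc_div a p; have := prime_gt0 p_prime.
have [->|] := posnP (a %/ p); first by lia.
by case: (p) => // p' /=; nia.
Qed.

Lemma radius_le_abs_fact n : r ^+ n <= v n.+1`!%:R.
Proof.
rewrite abs_nat ?fact_gt0 // -radius_exp -exprM.
by rewrite ler_wiXn2l ?logn_fact_le ?ltW ?radius_gt0 ?radius_lt1.
Qed.

Lemma fact_neq0 n : n`!%:R != 0 :> K.
Proof.
rewrite -abs_gt0 abs_nat ?fact_gt0 //.
by rewrite exprn_gt0 // ratio_p_gt0.
Qed.

Lemma radius_le_abs_nat n : r ^+ n <= v n.+1%:R.
Proof.
apply: le_trans (radius_le_abs_fact n) _.
by rewrite factS natrM vM ler_piMr ?abs_nat_le1.
Qed.

Lemma nat_neq0 n : n.+1%:R != 0 :> K.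
Proof.
rewrite -abs_gt0; apply: lt_le_trans (radius_le_abs_nat n).
by rewrite exprn_gt0 // radius_gt0.
Qed.

Lemma abs_expS_div_le t d n : v t < r -> r ^+ n <= v d ->
  v (t ^+ n.+1 / d) <= v t * (v t / r) ^+ n.
Proof.
move=> tr rd; have r_gt0 := radius_gt0.
have vd_gt0 : 0 < v d by apply: lt_le_trans rd; rewrite exprn_gt0.
rewrite vM absV absX exprS -mulrA ler_wpM2l // expr_div_n.
by rewrite ler_wpM2l ?exprn_ge0 // lef_pV2 ?posrE ?exprn_gt0.
Qed.

Lemma ratio_ge0 t : 0 <= v t / r.
Proof. by rewrite divr_ge0 // ltW // radius_gt0. Qed.

Lemma ratio_lt1 t : v t < r -> v t / r < 1.
Proof. by move=> tr; rewrite ltr_pdivrMr ?mul1r ?radius_gt0. Qed.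

Lemma abs_expS_div_le_abs t d n : v t < r -> r ^+ n <= v d ->
  v (t ^+ n.+1 / d) <= v t.
Proof.
move=> tr rd; apply: le_trans (abs_expS_div_le _ _ _ tr rd) _.
by rewrite ler_piMr // exprn_ile1 ?ratio_ge0 // ltW // ratio_lt1.
Qed.

Lemma abs_exp_divfact_le t n : v t < r -> v (t ^+ n / n`!%:R) <= (v t / r) ^+ n.
Proof.
case: n => [|n] tr; first by rewrite divr1 !expr0 abs1.
apply: le_trans (abs_expS_div_le _ _ _ tr (radius_le_abs_fact n)) _.
rewrite exprS ler_wpM2r ?exprn_ge0 ?ratio_ge0 //.
rewrite ler_peMr // invr_ge1 ?unitfE ?gt_eqF ?radius_gt0 //.
exact/ltW/radius_lt1.
Qed.

(** The linear term [m u] dominates the binomial expansion: the coefficient of [u ^ i] is [m / i]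
    times an integer, and [u ^ i / i] is smaller than a nonzero [u] once [i >= 2]. *)
Lemma abs_exp1D_sub1 u m : v u < r -> v ((1 + u) ^+ m - 1) = v m%:R * v u.
Proof.
case: m => [|m] ur; first by rewrite expr0 subrr abs0 mul0r.
have [->|u_neq0] := eqVneq u 0; first by rewrite addr0 expr1n subrr abs0 mulr0.
have m_neq0 := nat_neq0 m.
rewrite (addrC 1 u) exprD1n big_ord_recl big_ord_recl.
rewrite expr0 bin0 mulr1n addrC addKr expr1 bin1 -vM mulr_natl.
apply: abs_dominant; rewrite -mulr_natl vM.
have bound_lt : v m.+1%:R * (v u * (v u / r)) < v m.+1%:R * v u.
  by rewrite ltr_pM2l ?abs_gt0 // gtr_pMr ?abs_gt0 // ratio_lt1.
apply: le_lt_trans bound_lt.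
apply: abs_sum_le => [|i _ _].
  by do 2![apply: mulr_ge0 => //]; exact: ratio_ge0.
(* Absorption identity: [i.+2 * 'C(m.+1, i.+2) = m.+1 * 'C(m, i.+1)]. *)
have -> : u ^+ lift ord0 (lift ord0 i) *+ 'C(m.+1, lift ord0 (lift ord0 i)) =
    m.+1%:R * 'C(m, i.+1)%:R * (u ^+ i.+2 / i.+2%:R).
  rewrite !lift0 -natrM (mul_bin_diag m.+1 i.+1) natrM [RHS]mulrC mulrA.
  by rewrite divfK ?nat_neq0 // mulr_natr.
rewrite vM [v (m.+1%:R * _)]vM -mulrA ler_wpM2l //.
rewrite -[leRHS]mul1r ler_pM // ?abs_nat_le1 //.
apply: le_trans (abs_expS_div_le _ _ _ ur (radius_le_abs_nat i.+1)) _.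
rewrite ler_wpM2l // exprS ler_piMr ?ratio_ge0 //.
by rewrite exprn_ile1 ?ratio_ge0 // ltW // ratio_lt1.
Qed.

(** * Limits and series *)

Lemma vcvgP u l : vcvg v u l <->
  forall e, 0 < e -> exists N, forall n, (N <= n)%N -> v (u n - l) < e.
Proof.
rewrite /vcvg; split=> [/cvgr0Pnorm_lt ul e e_gt0|ul].
  have [N _ Nul] := ul e e_gt0; exists N => n Nn.
  by have := Nul n Nn; rewrite /= ger0_norm.
apply/cvgr0Pnorm_lt => e e_gt0; have [N Nul] := ul e e_gt0.
by exists N => // n /= Nn; rewrite ger0_norm ?Nul.
Qed.

Lemma vcvg_squeeze (u : nat -> K) (w : nat -> R) l :
  w @ \oo --> (0 : R) -> (forall n, v (u n - l) <= w n) -> vcvg v u l.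
Proof.
move=> w0 uw; apply/vcvgP => e e_gt0.
have /cvgr0Pnorm_lt/(_ e e_gt0)[N _ Nw] := w0.
exists N => n Nn; apply: le_lt_trans (uw n) _.
exact: le_lt_trans (ler_norm _) (Nw n Nn).
Qed.

Lemma vcvg_cst l : vcvg v (fun=> l) l.
Proof. by apply/vcvgP => e; exists 0%N => n _; rewrite subrr abs0. Qed.

Lemma vcvgD u w l m :
  vcvg v u l -> vcvg v w m -> vcvg v (fun n => u n + w n) (l + m).
Proof.
move=> /vcvgP ul /vcvgP wm; apply/vcvgP => e e_gt0.
have [[N Nu] [M Mw]] := (ul e e_gt0, wm e e_gt0).
exists (maxn N M) => n; rewrite geq_max => /andP[Nn Mn].
by rewrite opprD addrACA; apply: abs_addr_lt; [exact: Nu|exact: Mw].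
Qed.

Lemma vcvgZ a u l : vcvg v u l -> vcvg v (fun n => a * u n) (a * l).
Proof.
move=> /vcvgP ul; apply/vcvgP => e e_gt0.
have [->|a_neq0] := eqVneq a 0.
  by exists 0%N => n _; rewrite !mul0r subrr abs0.
have [|N Nu] := ul (e / v a); first by rewrite divr_gt0 ?abs_gt0.
by exists N => n Nn; rewrite -mulrBr vM mulrC -ltr_pdivlMr ?abs_gt0 ?Nu.
Qed.

Lemma vcvg_sum (I : Type) (s : seq I) (u : I -> nat -> K) (l : I -> K) :
  (forall i, vcvg v (u i) (l i)) ->
  vcvg v (fun n => \sum_(i <- s) u i n) (\sum_(i <- s) l i).
Proof.
move=> ul; elim: s => [|i s IHs].
  by under eq_fun do rewrite big_nil; rewrite big_nil; apply: vcvg_cst.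
under eq_fun do rewrite big_cons.
by rewrite big_cons; apply: vcvgD.
Qed.

Lemma vcvg_unique u l m : vcvg v u l -> vcvg v u m -> l = m.
Proof.
move=> /vcvgP ul /vcvgP um; apply/eqP; rewrite -subr_eq0 -abs_eq0.
rewrite eq_le v_ge0 andbT leNgt; apply/negP => lm_gt0.
have [[N Nu] [M Mu]] := (ul _ lm_gt0, um _ lm_gt0).
suff: v (l - m) < v (l - m) by rewrite ltxx.
rewrite -{1}(subrKA (u (maxn N M))); apply: abs_addr_lt.
  by rewrite abs_sub Nu ?leq_maxl.
by rewrite Mu ?leq_maxr.
Qed.

Lemma vlimE u l : vcvg v u l -> vlim v u = l.
Proof. by move=> ul; apply: xget_unique => // m /vcvg_unique; apply. Qed.

(** If [C < v l], a late [u n] is closer to [l] than [v l] and itself smaller than [v l], which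
    forces [v l < v l]. *)
Lemma vcvg_abs_le u l N C :
  (forall n, (N <= n)%N -> v (u n) <= C) -> vcvg v u l -> v l <= C.
Proof.
move=> uC /vcvgP ul; rewrite leNgt; apply/negP => Cl.
have C_ge0 := le_trans (v_ge0 _) (uC N (leqnn N)).
have [M Mul] := ul _ (le_lt_trans C_ge0 Cl).
have := Mul (maxn N M) (leq_maxr N M); rewrite abs_sub => lt_l.
have: v l < v l; last by rewrite ltxx.
rewrite -{1}(subrK (u (maxn N M)) l); apply: abs_addr_lt => //.
by apply: le_lt_trans Cl; rewrite uC ?leq_maxl.
Qed.

Definition has_vsum (a : nat -> K) (s : K) : Prop :=
  vcvg v (fun N => \sum_(0 <= n < N) a n) s.

Lemma vseriesE a s : has_vsum a s -> vseries v a = s.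
Proof. exact: vlimE. Qed.

Lemma geom_lt (rho e : R) : 0 <= rho -> rho < 1 -> 0 < e ->
  exists N, forall n, (N <= n)%N -> rho ^+ n < e.
Proof.
move=> rho_ge0 rho_lt1 e_gt0.
have /cvgr0Pnorm_lt/(_ e e_gt0)[N _ Nr] : rho ^+ n @[n --> \oo] --> (0 : R).
  by apply: cvg_expr; rewrite ger0_norm.
by exists N => n /Nr /=; rewrite ger0_norm ?exprn_ge0.
Qed.

(** By the ultrametric inequality a block of terms is no larger than the bound on its first term; no
    geometric sum appears. *)
Lemma abs_tail_le (a : nat -> K) (rho : R) N M : 0 <= rho -> rho <= 1 ->
  (forall n, v (a n) <= rho ^+ n) -> (N <= M)%N ->
  v (\sum_(0 <= n < M) a n - \sum_(0 <= n < N) a n) <= rho ^+ N.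
Proof.
move=> rho_ge0 rho_le1 a_le NM.
rewrite (big_cat_nat (leq0n _) NM) //= addrAC subrr add0r.
apply: abs_sum_le => [|n]; rewrite ?exprn_ge0 //.
rewrite mem_index_iota => /andP[Nn _] _.
by apply: le_trans (a_le n) _; apply: ler_wiXn2l.
Qed.

Lemma vsum_tail_le a s (rho : R) N : 0 <= rho -> rho <= 1 ->
  (forall n, v (a n) <= rho ^+ n) -> has_vsum a s ->
  v (s - \sum_(0 <= n < N) a n) <= rho ^+ N.
Proof.
move=> rho_ge0 rho_le1 a_le as_.
have := vcvgD _ _ _ _ as_ (vcvg_cst (- \sum_(0 <= n < N) a n)).
by apply: vcvg_abs_le => M; apply: abs_tail_le.
Qed.

Lemma has_vsum_geom (a : nat -> K) (rho : R) : 0 <= rho -> rho < 1 ->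
  (forall n, v (a n) <= rho ^+ n) -> has_vsum a (vseries v a).
Proof.
move=> rho_ge0 rho_lt1 a_le.
suff [s as_] : exists s, has_vsum a s by rewrite (vseriesE _ _ as_).
apply: (Cp_complete HK) => e e_gt0.
have [N Nrho] := geom_lt _ _ rho_ge0 rho_lt1 e_gt0.
exists N => m n; wlog nm : m n / (n <= m)%N => [IH|] Nm Nn.
  by case/orP: (leq_total n m) => ?; [|rewrite abs_sub]; apply: IH.
apply: le_lt_trans (Nrho _ Nn).
exact: abs_tail_le rho_ge0 (ltW rho_lt1) a_le nm.
Qed.

Lemma has_vsumD a b s1 s2 : has_vsum a s1 -> has_vsum b s2 ->
  has_vsum (fun n => a n + b n) (s1 + s2).
Proof.
move=> a1 b2; rewrite /has_vsum; under eq_fun do rewrite big_split /=.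
exact: vcvgD.
Qed.

Lemma has_vsumZ c a s : has_vsum a s -> has_vsum (fun n => c * a n) (c * s).
Proof.
move=> as_; rewrite /has_vsum; under eq_fun do rewrite -mulr_sumr.
exact: vcvgZ.
Qed.

Lemma has_vsumB a b s1 s2 : has_vsum a s1 -> has_vsum b s2 ->
  has_vsum (fun n => a n - b n) (s1 - s2).
Proof.
move=> a1 /(has_vsumZ (-1)); rewrite mulN1r => /(has_vsumD _ _ _ _ a1).
by under eq_fun do rewrite mulN1r.
Qed.

Lemma has_vsumS a s : has_vsum a s -> has_vsum (fun n => a n.+1) (s - a 0%N).
Proof.
move=> /vcvgP as_; apply/vcvgP => e e_gt0; have [N Na] := as_ e e_gt0.
exists N => n Nn; rewrite opprB addrA [X in X - s]addrC.
by have := Na n.+1 (leqW Nn); rewrite big_nat_recl.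
Qed.

Lemma has_vsum_abs_le a s C :
  has_vsum a s -> (forall n, v (a n) <= C) -> v s <= C.
Proof.
move=> as_ aC; apply: (vcvg_abs_le _ _ 0 C _ as_) => N _.
apply: abs_sum_le => //.
exact: le_trans (v_ge0 _) (aC 0%N).
Qed.

Lemma has_vsum_finite a M : (forall n, (M <= n)%N -> a n = 0) ->
  has_vsum a (\sum_(0 <= n < M) a n).
Proof.
move=> a0; apply/vcvgP => e e_gt0; exists M => n Mn.
rewrite (big_cat_nat (leq0n _) Mn) //= addrAC subrr add0r.
rewrite big_nat big1 ?abs0 // => i /andP[Mi _].
exact: a0.
Qed.

Lemma sum_conv_partial (a b : nat -> K) N :
  \sum_(0 <= n < N) \sum_(0 <= i < n.+1) a i * b (n - i)%N =
  \sum_(0 <= i < N) a i * \sum_(0 <= j < N - i) b j.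
Proof.
elim: N => [|N IHN]; first by rewrite !big_geq.
rewrite big_nat_recr //= IHN.
rewrite big_nat_recr //= [in RHS]big_nat_recr //= subnn subSnn big_nat1.
rewrite addrA; congr (_ + _); rewrite -big_split /=.
rewrite big_nat [RHS]big_nat; apply: eq_bigr => i /andP[_ iN].
by rewrite -mulrDr subSn 1?ltnW // big_nat_recr.
Qed.

(** Grouped by [i], the partial Cauchy product differs from [s2] times the partial sum of [a] by the
    terms [a i] times a tail of [b] starting at [N - i]. Each is at most
    [rho ^ i * rho ^ (N - i) = rho ^ N]. *)
Lemma has_vsumM a b (rho : R) s1 s2 : 0 <= rho -> rho < 1 ->
  (forall n, v (a n) <= rho ^+ n) -> (forall n, v (b n) <= rho ^+ n) ->
  has_vsum a s1 -> has_vsum b s2 ->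
  has_vsum (fun n => \sum_(0 <= i < n.+1) a i * b (n - i)%N) (s1 * s2).
Proof.
move=> rho_ge0 rho_lt1 a_le b_le as1 bs2.
have as1' : has_vsum (fun n => s2 * a n) (s1 * s2).
  by rewrite mulrC; apply: has_vsumZ.
suff diff0 : vcvg v (fun N => \sum_(0 <= i < N) a i * \sum_(0 <= j < N - i) b j
    - \sum_(0 <= n < N) s2 * a n) 0.
  rewrite -[s1 * s2]addr0; have := vcvgD _ _ _ _ as1' diff0.
  under eq_fun do rewrite addrC subrK -sum_conv_partial.
  exact.
apply: (vcvg_squeeze _ (fun N => rho ^+ N)).
  by apply: cvg_expr; rewrite ger0_norm.
move=> N; rewrite subr0 -sumrB.
apply: abs_sum_le => [|i]; first exact: exprn_ge0.
rewrite mem_index_iota => /andP[_ iN] _.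
rewrite [s2 * _]mulrC -mulrBr vM -(subnKC (ltnW iN)) exprD ler_pM //.
rewrite addKn abs_sub.
exact: vsum_tail_le rho_ge0 (ltW rho_lt1) b_le bs2.
Qed.

(** * The binomial series and p-adic powers *)

(** Step 0 gives powers, hence the exponential series, and step 1 gives falling factorials, hence
    the binomial series. Keeping [e] as a parameter lets both series share every identity and
    estimate. *)
Definition step_fact (e : nat) (z : K) (n : nat) : K :=
  \prod_(0 <= i < n) (z - (e * i)%:R).

Definition step_binom (e : nat) (z : K) (n : nat) : K :=
  step_fact e z n / n`!%:R.

(* (1 + e t)^(z / e), which is exp (z t) for [e = 0]. *)
Definition step_series (e : nat) (z t : K) : K :=
  vseries v (fun n => step_binom e z n * t ^+ n).

Lemma step_factS e z n :
  step_fact e z n.+1 = step_fact e z n * (z - (e * n)%:R).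
Proof. by rewrite /step_fact big_nat_recr. Qed.

Lemma step_fact0 e n : step_fact e 0 n = (n == 0%N)%:R.
Proof.
case: n => [|n]; first by rewrite /step_fact big_geq.
by rewrite /step_fact big_nat_recl // muln0 subr0 mul0r.
Qed.

Lemma step_binom0 e z : step_binom e z 0 = 1.
Proof. by rewrite /step_binom /step_fact big_geq // fact0 divr1. Qed.

Lemma step_binomS e z n :
  n.+1%:R * step_binom e z n.+1 = (z - (e * n)%:R) * step_binom e z n.
Proof.
rewrite /step_binom step_factS factS !natrM.
move: (nat_neq0 n) (fact_neq0 n); move: n.+1%:R n`!%:R => d f d_neq0 f_neq0.
by field; rewrite ?d_neq0 ?f_neq0.
Qed.

Lemma step_binom1 e z : step_binom e z 1 = z.
Proof.
by have := step_binomS e z 0; rewrite step_binom0 muln0 subr0 mul1r mulr1.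
Qed.

(* Both sides satisfy [(n + 1) a_(n+1) = (z + w - e n) a_n]. *)
Lemma step_vandermonde e z w n :
  \sum_(0 <= i < n.+1) step_binom e z i * step_binom e w (n - i) =
  step_binom e (z + w) n.
Proof.
elim: n => [|n IHn].
  by rewrite big_nat1 !step_binom0 mul1r.
apply: (mulfI (nat_neq0 n)); rewrite step_binomS -IHn !mulr_sumr.
(* Split [n.+1] as [i + (n.+1 - i)], so that the recurrence can be applied to one factor of each
   product. *)
have -> : \sum_(0 <= i < n.+2) n.+1%:R *
      (step_binom e z i * step_binom e w (n.+1 - i)) =
    \sum_(0 <= i < n.+2) i%:R * step_binom e z i * step_binom e w (n.+1 - i) +
    \sum_(0 <= i < n.+2)
      step_binom e z i * ((n.+1 - i)%:R * step_binom e w (n.+1 - i)).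
  rewrite -big_split [LHS]big_nat [RHS]big_nat.
  apply: eq_bigr => i /andP[_ iN] /=.
  have -> : n.+1%:R = i%:R + (n.+1 - i)%:R :> K by rewrite -natrD subnKC.
  by rewrite mulrDl mulrA [_%:R * (_ * _)]mulrCA.
(* The first sum loses its term [i = 0] and the second its term [i = n.+1]; after a shift both run
   over the same range. *)
rewrite big_nat_recl // mul0r mul0r add0r.
rewrite [X in _ + X]big_nat_recr //= subnn mul0r mulr0 addr0 -big_split.
rewrite [LHS]big_nat [RHS]big_nat; apply: eq_bigr => i /andP[_ iN] /=.
rewrite step_binomS subSS (subSn (ltnSE iN)) step_binomS.
have -> : (e * n)%:R = (e * i)%:R + (e * (n - i))%:R :> K.
  by rewrite -natrD -mulnDr subnKC.
rewrite -mulrA [step_binom e z i * (_ * _)]mulrCA -mulrDl; congr (_ * _).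
by rewrite opprD addrACA.
Qed.

Lemma abs_step_fact_le1 e z n : v z <= 1 -> v (step_fact e z n) <= 1.
Proof.
move=> z1; elim: n => [|n IHn]; first by rewrite /step_fact big_geq ?abs1.
rewrite step_factS vM mulr_ile1 //.
by apply: abs_subr_le => //; apply: abs_nat_le1.
Qed.

Lemma abs_step_term_le e z t n : v z <= 1 -> v t < r ->
  v (step_binom e z n * t ^+ n) <= (v t / r) ^+ n.
Proof.
move=> z1 tr; rewrite /step_binom -mulrA [_^-1 * _]mulrC vM.
apply: le_trans (abs_exp_divfact_le _ n tr).
by rewrite ler_piMl // abs_step_fact_le1.
Qed.

Lemma step_seriesP e z t : v z <= 1 -> v t < r ->
  has_vsum (fun n => step_binom e z n * t ^+ n) (step_series e z t).
Proof.
move=> z1 tr; apply: (has_vsum_geom _ _ (ratio_ge0 t) (ratio_lt1 _ tr)) => n.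
exact: abs_step_term_le.
Qed.

Lemma step_seriesD e z w t : v z <= 1 -> v w <= 1 -> v t < r ->
  step_series e (z + w) t = step_series e z t * step_series e w t.
Proof.
move=> z1 w1 tr; apply: vseriesE.
have := has_vsumM _ _ _ _ _ (ratio_ge0 t) (ratio_lt1 _ tr)
  (fun n => abs_step_term_le e z t n z1 tr)
  (fun n => abs_step_term_le e w t n w1 tr)
  (step_seriesP e z t z1 tr) (step_seriesP e w t w1 tr).
congr has_vsum; apply/funext => n.
rewrite -step_vandermonde mulr_suml big_nat [RHS]big_nat.
apply: eq_bigr => i /andP[_ iN].
by rewrite mulrACA -exprD subnKC.
Qed.

Lemma abs_step_series_sub1 e z t : v z <= 1 -> v t < r ->
  v (step_series e z t - 1) <= v t.
Proof.
move=> z1 tr; have := has_vsumS _ _ (step_seriesP e z t z1 tr).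
rewrite step_binom0 mul1r expr0 => /has_vsum_abs_le.
apply=> n; rewrite /step_binom -mulrA [_^-1 * _]mulrC vM.
apply: le_trans (abs_expS_div_le_abs _ _ _ tr (radius_le_abs_fact n)).
by rewrite ler_piMl // abs_step_fact_le1.
Qed.

(* The coefficient of [z] in [step_fact e z n.+1]. *)
Definition step_lin (e n : nat) : K := \prod_(0 <= i < n) - (e * i.+1)%:R.

(** Once a factor [z] is taken out, it remains to compare the product of the [z - e (i + 1)] with
    its value at [z = 0]; by induction the two differ by at most [v z]. *)
Lemma abs_step_fact_lin e z n : v z <= 1 ->
  v (step_fact e z n.+1 - z * step_lin e n) <= v z ^+ 2.
Proof.
move=> z1; rewrite /step_fact big_nat_recl // muln0 subr0 -mulrBr vM expr2.
rewrite ler_wpM2l // /step_lin; elim: n => [|n IHn].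
  by rewrite !big_geq // subrr abs0.
rewrite !big_nat_recr //=.
set a := \prod_(_ <= _ < _) _ in IHn *; set b := \prod_(_ <= _ < _) _ in IHn *.
have -> : a * (z - (e * n.+1)%:R) - b * - (e * n.+1)%:R =
   a * z - (a - b) * (e * n.+1)%:R by ring.
apply: abs_subr_le; rewrite vM.
  rewrite ler_piMl //; elim: (n) @a {b IHn} => [|m IHm] /=.
    by rewrite big_geq ?abs1.
  rewrite big_nat_recr //= vM mulr_ile1 //.
  by apply: abs_subr_le => //; apply: abs_nat_le1.
by apply: le_trans IHn; rewrite ler_piMr // abs_nat_le1.
Qed.

(** [L] is the derivative of the series in [z] at 0: it is [t] for [e = 0] and log (1 + t) for
    [e = 1]. *)
Lemma abs_step_series_lin e z t L : v z <= 1 -> v t < r ->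
  has_vsum (fun n => step_lin e n * (t ^+ n.+1 / n.+1`!%:R)) L ->
  v (step_series e z t - 1 - z * L) <= v z ^+ 2.
Proof.
move=> z1 tr /(has_vsumZ z) Lsum.
have := has_vsumS _ _ (step_seriesP e z t z1 tr).
rewrite step_binom0 mul1r expr0.
move=> /has_vsumB /(_ Lsum) /has_vsum_abs_le; apply=> n.
have -> : step_binom e z n.+1 * t ^+ n.+1 -
    z * (step_lin e n * (t ^+ n.+1 / n.+1`!%:R)) =
    (step_fact e z n.+1 - z * step_lin e n) * (t ^+ n.+1 / n.+1`!%:R).
  by rewrite /step_binom; ring.
rewrite vM -[leRHS]mulr1 ler_pM ?abs_step_fact_lin //.
apply: le_trans (abs_exp_divfact_le _ _ tr) _.
by rewrite exprn_ile1 ?ratio_ge0 // ltW // ratio_lt1.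
Qed.

(* At [p ^ j z] the two functions agree up to [p ^ - 2 j], while the [p ^ j]-th
   power map only shrinks [F z / G z - 1] by the factor [p ^ - j]. *)
Lemma unit_disk_hom_unique (F G : K -> K) (L : K) :
  {in [pred z | v z <= 1] &, {morph F : z w / z + w >-> z * w}} ->
  {in [pred z | v z <= 1] &, {morph G : z w / z + w >-> z * w}} ->
  (forall z, v z <= 1 -> v (F z - 1) < r) ->
  (forall z, v z <= 1 -> v (G z - 1) < r) ->
  (forall z, v z <= 1 -> v (F z - 1 - z * L) <= v z ^+ 2) ->
  (forall z, v z <= 1 -> v (G z - 1 - z * L) <= v z ^+ 2) ->
  forall z, v z <= 1 -> F z = G z.
Proof.
move=> FD GD F1 G1 FL GL z z1.
have near1 x : v (x - 1) < r -> v x = 1.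
  by move=> x1; apply/abs_near1/(lt_trans x1 radius_lt1).
have mulz_le1 m : v (m%:R * z) <= 1 by rewrite vM mulr_ile1 ?abs_nat_le1.
have homX (H : K -> K) m :
    {in [pred z | v z <= 1] &, {morph H : z w / z + w >-> z * w}} ->
    (forall z, v z <= 1 -> v (H z - 1) < r) -> H (m%:R * z) = H z ^+ m.
  move=> HD H1; have vHz := near1 _ (H1 _ z1).
  have Hz_neq0 : H z != 0 by rewrite -abs_gt0 vHz.
  elim: m => [|m IHm].
    apply: (mulfI Hz_neq0); rewrite -HD ?inE ?mul0r ?abs0 //.
    by rewrite addr0 expr0 mulr1.
  by rewrite -natr1 mulrDl mul1r HD ?inE // IHm exprSr.
have vG : v (G z) = 1 by apply/near1/G1.
have Gz_neq0 : G z != 0 by rewrite -abs_gt0 vG.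
pose u := F z / G z - 1.
have vu : v u = v (F z - G z).
  rewrite (_ : u = (F z - G z) / G z); last by rewrite /u mulrBl divff.
  by rewrite vM absV vG invr1 mulr1.
have ur : v u < r.
  by rewrite vu -(subrKA 1); apply: abs_addr_lt; rewrite ?F1 // abs_sub G1.
have u_le j : v u <= pi ^+ j.
  have pj : v (p ^ j)%:R = pi ^+ j by rewrite natrX absX (Cp_abs_p HK).
  (* Multiplied by [v (p ^ j)], the left side becomes [v ((1 + u) ^ (p ^ j) - 1)], and that power is
     [F y / G y] for [y = p ^ j z]. *)
  rewrite -(@ler_pM2l _ (pi ^+ j)) ?exprn_gt0 ?ratio_p_gt0 // -pj.
  rewrite -abs_exp1D_sub1 // /u subrKC expr_div_n -!homX //.
  set y := _%:R * z; have y1 : v y <= 1 by apply: mulz_le1.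
  have vGy : v (G y) = 1 by apply/near1/G1.
  have Gy_neq0 : G y != 0 by rewrite -abs_gt0 vGy.
  rewrite (_ : F y / G y - 1 = (F y - G y) / G y); last by rewrite mulrBl divff.
  rewrite vM absV vGy invr1 mulr1.
  apply: (@le_trans _ _ (v y ^+ 2)).
    have -> : F y - G y = (F y - 1 - y * L) - (G y - 1 - y * L) by ring.
    by apply: abs_subr_le; [exact: FL|exact: GL].
  have vy_le : v y <= pi ^+ j.
    by rewrite /y vM pj ler_piMr // exprn_ge0 // ltW // ratio_p_gt0.
  by rewrite expr2 pj ler_pM.
apply/eqP; rewrite -subr_eq0 -abs_eq0 -vu eq_le v_ge0 andbT leNgt.
apply/negP => u_gt0.
have [N Nu] := geom_lt _ _ (ltW ratio_p_gt0) ratio_p_lt1 u_gt0.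
by have := le_lt_trans (u_le N) (Nu N (leqnn N)); rewrite ltxx.
Qed.

Lemma padic_logP a : v (a - 1) < r ->
  has_vsum (fun n => (-1) ^+ n * (a - 1) ^+ n.+1 / n.+1%:R) (padic_log v a).
Proof.
move=> ar; apply: (has_vsum_geom _ _ (ratio_ge0 (a - 1)) (ratio_lt1 _ ar)) => n.
rewrite -mulrA vM absX absN abs1 expr1n mul1r.
apply: le_trans (abs_expS_div_le _ _ _ ar (radius_le_abs_nat n)) _.
rewrite ler_piMl ?exprn_ge0 ?ratio_ge0 // ltW //.
exact: lt_trans radius_lt1.
Qed.

Lemma abs_padic_log a : v (a - 1) < r -> v (padic_log v a) < r.
Proof.
move=> ar; apply: le_lt_trans (ar).
apply: has_vsum_abs_le (padic_logP a ar) _ => n.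
rewrite -mulrA vM absX absN abs1 expr1n mul1r.
exact: abs_expS_div_le_abs ar (radius_le_abs_nat n).
Qed.

Lemma padic_expE z w : padic_exp v (z * w) = step_series 0 z w.
Proof.
congr (vseries v _); apply/funext => n; rewrite /step_binom.
have -> : step_fact 0 z n = z ^+ n.
  elim: n => [|n IHn]; first by rewrite /step_fact big_geq.
  by rewrite step_factS IHn mul0n subr0 exprSr.
by rewrite exprMn; ring.
Qed.

Lemma step_lin1 n : step_lin 1 n = (-1) ^+ n * n`!%:R.
Proof.
elim: n => [|n IHn]; first by rewrite /step_lin big_geq // mulr1.
rewrite /step_lin big_nat_recr //= -/(step_lin 1 n) IHn mul1n factS natrM exprS.
ring.
Qed.

Lemma padic_powE a z : v (a - 1) < r -> v z <= 1 ->
  padic_pow v a z = step_series 1 z (a - 1).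
Proof.
move=> ar; have Lr := abs_padic_log a ar; set L := padic_log v a in Lr.
rewrite /padic_pow padic_expE -/L; move: z.
(* The common derivative at 0 is log a: for step 0 only the first term of the derivative series
   survives, and for step 1 that series is the logarithm series itself. *)
apply: (unit_disk_hom_unique (step_series 0 ^~ L) (step_series 1 ^~ (a - 1)) L).
- by move=> z w z1 w1; apply: step_seriesD.
- by move=> z w z1 w1; apply: step_seriesD.
- by move=> z z1; apply: le_lt_trans (abs_step_series_sub1 _ _ _ z1 Lr) Lr.
- by move=> z z1; apply: le_lt_trans (abs_step_series_sub1 _ _ _ z1 ar) ar.
- move=> z z1; apply: abs_step_series_lin => //.
  have := @has_vsum_finite (fun n => step_lin 0 n * (L ^+ n.+1 / n.+1`!%:R)) 1.
  rewrite big_nat1 /step_lin big_geq // mul1r divr1; apply => -[//|n] _.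
  by rewrite big_nat_recl // mul0n oppr0 !mul0r.
- move=> z z1; apply: abs_step_series_lin => //.
  have := padic_logP a ar; congr has_vsum; apply/funext => n.
  rewrite step_lin1 factS natrM.
  move: (nat_neq0 n) (fact_neq0 n); move: n.+1%:R n`!%:R => d f d_neq0 f_neq0.
  by field; rewrite ?d_neq0 ?f_neq0.
Qed.

Lemma padic_powD a z w : v (a - 1) < r -> v z <= 1 -> v w <= 1 ->
  padic_pow v a (z + w) = padic_pow v a z * padic_pow v a w.
Proof.
move=> ar z1 w1; rewrite !padic_powE ?step_seriesD //.
exact: abs_addr_le.
Qed.

Lemma padic_pow0 a : v (a - 1) < r -> padic_pow v a 0 = 1.
Proof.
move=> ar; rewrite padic_powE ?abs0 //; apply: vseriesE.
have := @has_vsum_finite (fun n => step_binom 1 0 n * (a - 1) ^+ n) 1.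
rewrite big_nat1 /step_binom step_fact0 divr1 mulr1; apply => -[//|n] _.
by rewrite step_fact0 !mul0r.
Qed.

Lemma padic_pow1 a : v (a - 1) < r -> padic_pow v a 1 = a.
Proof.
move=> ar; rewrite padic_powE ?abs1 //; apply: vseriesE.
have := @has_vsum_finite (fun n => step_binom 1 1 n * (a - 1) ^+ n) 2.
rewrite !big_nat_recr // big_geq //= step_binom0 step_binom1.
rewrite add0r !mul1r expr0 expr1 subrKC.
apply=> -[//|[//|n]] _.
(* From degree 2 on, the falling factorial of 1 contains the factor [1 - 1]. *)
rewrite /step_binom /step_fact 2?big_nat_recl //= muln1 subrr.
by rewrite mul0r mulr0 !mul0r.
Qed.

Lemma padic_powMn a m z : v (a - 1) < r -> v z <= 1 ->
  padic_pow v a (m%:R * z) = padic_pow v a z ^+ m.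
Proof.
move=> ar z1; elim: m => [|m IHm]; first by rewrite mul0r padic_pow0.
rewrite -natr1 mulrDl mul1r padic_powD ?IHm ?exprSr //.
by rewrite vM mulr_ile1 // abs_nat_le1.
Qed.

Lemma padic_pow_nat a m : v (a - 1) < r -> padic_pow v a m%:R = a ^+ m.
Proof. by move=> ar; rewrite -[m%:R]mulr1 padic_powMn ?abs1 ?padic_pow1. Qed.

Lemma abs_padic_pow_sub1 a z : v (a - 1) < r -> v z <= 1 ->
  v (padic_pow v a z - 1) <= v (a - 1).
Proof. by move=> ar z1; rewrite padic_powE ?abs_step_series_sub1. Qed.

(** * Uniqueness of power series coefficients *)

(** Late terms are differences of two partial sums within 1 of [s]; the finitely many others are
    bounded by the sum of their absolute values. *)
Lemma has_vsum_bounded a s : has_vsum a s -> exists C, forall n, v (a n) <= C.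
Proof.
move=> /vcvgP as_; have [N Na] := as_ 1 ltr01.
have sum_ge0 : 0 <= \sum_(0 <= n < N) v (a n) by apply: sumr_ge0.
exists (1 + \sum_(0 <= n < N) v (a n)) => n.
have [Nn|nN] := leqP N n.
  apply: (@le_trans _ _ 1); last by rewrite lerDl.
  have -> : a n = (\sum_(0 <= i < n.+1) a i - s) - (\sum_(0 <= i < n) a i - s).
    by rewrite big_nat_recr //=; ring.
  by apply: abs_subr_le; apply/ltW/Na => //; apply: leqW.
rewrite (bigD1_seq n) ?iota_uniq ?mem_index_iota //= addrCA lerDl.
by rewrite addr_ge0 // sumr_ge0.
Qed.

(* Substituting [p ^ j t0] for [t], the lowest nonzero term dominates as [j]
   grows. *)
Lemma power_series_eq0 d :
  (forall t, v t < r -> has_vsum (fun n => d n * t ^+ n) 0) ->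
  forall n, d n = 0.
Proof.
move=> d0 n; apply/eqP; apply: contrapT => /negP dn_neq0.
have [m dm_neq0 m_min] := ex_minnP (ex_intro (fun n => d n != 0) n dn_neq0).
have [k kr] := geom_lt _ _ (ltW ratio_p_gt0) ratio_p_lt1 radius_gt0.
pose t0 : K := p%:R ^+ k.
have abs_pX j : v (p%:R ^+ j) = pi ^+ j by rewrite absX (Cp_abs_p HK).
have t0r : v t0 < r by rewrite abs_pX kr.
have [C dC] := has_vsum_bounded _ _ (d0 t0 t0r).
have C_ge0 := le_trans (v_ge0 _) (dC 0%N).
have piX_ge0 j : 0 <= pi ^+ j by rewrite exprn_ge0 // ltW // ratio_p_gt0.
have bound j : v (d m * t0 ^+ m) <= C * pi ^+ j.
  pose t := t0 * p%:R ^+ j.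
  have tr : v t < r.
    apply: le_lt_trans t0r; rewrite vM ler_piMr // abs_pX.
    by rewrite exprn_ile1 ?ltW ?ratio_p_gt0 ?ratio_p_lt1.
  have single : has_vsum (fun n => (n == m)%:R * (d m * t ^+ m)) (d m * t ^+ m).
    have := @has_vsum_finite (fun n => (n == m)%:R * (d m * t ^+ m)) m.+1.
    rewrite big_nat_recr //= eqxx mul1r big_nat big1 ?add0r => [|i /andP[_ im]].
      by apply=> i mi; rewrite gtn_eqF ?mul0r.
    by rewrite ltn_eqF ?mul0r.
  have tE i : d i * t ^+ i = d i * t0 ^+ i * p%:R ^+ (j * i).
    by rewrite exprMn mulrA exprM.
  (* In the series minus its [m]-th term, lower terms vanish by minimality of [m] and each higher
     one carries a factor at most [pi ^ (j (m + 1))]. The [m]-th term carries only [pi ^ (j m)], so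
     cancelling leaves [C * pi ^ j]. *)
  suff : v (0 - d m * t ^+ m) <= C * pi ^+ (j * m.+1).
    rewrite sub0r absN tE vM abs_pX mulnS exprD mulrA.
    by rewrite ler_pM2r // exprn_gt0 // ratio_p_gt0.
  apply: has_vsum_abs_le (has_vsumB _ _ _ _ (d0 t tr) single) _ => i.
  have [im|mi|->] := ltngtP i m; last first.
  - by rewrite mul1r subrr abs0 mulr_ge0.
  - rewrite mul0r subr0 tE vM abs_pX ler_pM //.
    by rewrite ler_wiXn2l ?leq_mul // ltW // ?ratio_p_gt0 ?ratio_p_lt1.
  - rewrite mul0r subr0 (_ : d i = 0) ?mul0r ?abs0 ?mulr_ge0 //.
    by apply/eqP; apply: contraTT im => /m_min; rewrite leqNgt.
have a_gt0 : 0 < v (d m * t0 ^+ m).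
  by rewrite vM absX abs_pX mulr_gt0 ?abs_gt0 // !exprn_gt0 ?ratio_p_gt0.
have C_gt0 : 0 < C.
  by have := lt_le_trans a_gt0 (bound 0%N); rewrite expr0 mulr1.
have [N Nlt] :=
  geom_lt _ _ (ltW ratio_p_gt0) ratio_p_lt1 (divr_gt0 a_gt0 C_gt0).
have := Nlt N (leqnn N); rewrite ltr_pdivlMr // mulrC => lt_a.
by have := le_lt_trans (bound N) lt_a; rewrite ltxx.
Qed.

(** * p-adic integers and Stirling numbers *)

Lemma padic_int_abs_le1 x : padic_int v x -> v x <= 1.
Proof.
move=> /(_ 1 ltr01)[_ [m _ <-] xm].
by rewrite -(subrK m%:~R x); apply: abs_addr_le; rewrite ?abs_int_le1 ?ltW.
Qed.

Lemma step_fact_stirling z n : step_fact 1 z n =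
  \sum_(0 <= k < n.+1) (stirling1 n k)%:~R * z ^+ k.
Proof.
pose P : {poly K} := \prod_(0 <= i < n) ('X - (i%:R)%:P).
have PE : P = map_poly intr (\prod_(0 <= i < n) ('X - (i%:Z)%:P)).
  rewrite rmorph_prod; apply: eq_bigr => i _.
  by rewrite rmorphB /= map_polyX map_polyC.
have -> : step_fact 1 z n = P.[z].
  rewrite horner_prod; apply: eq_bigr => i _.
  by rewrite hornerXsubC mul1n.
rewrite (@horner_coef_wide _ n.+1) ?big_mkord; last first.
  by rewrite size_prod_XsubC size_iota subn0.
by apply: eq_bigr => i _; rewrite PE coef_map.
Qed.

(** * Fermionic integrals *)

Section Fermionic.
Context {q : K}.
Hypotheses (p_odd : odd p) (qr : v (q - 1) < r).

Definition fermionic_sum (N : nat) (f : nat -> K) : K :=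
  (qnumber_neg q (p ^ N)%N)^-1 * \sum_(0 <= y < (p ^ N)%N) f y * (- q) ^+ y.

Definition has_fermionic (f : nat -> K) (I : K) : Prop :=
  vcvg v (fermionic_sum ^~ f) I.

Lemma abs_qX_sub1 m : v (q ^+ m - 1) <= v m%:R.
Proof.
rewrite -{1}(subrKC 1 q) abs_exp1D_sub1 // ler_piMr // ltW //.
exact: lt_trans radius_lt1.
Qed.

Lemma abs_q : v q = 1.
Proof. exact/abs_near1/(lt_trans qr)/radius_lt1. Qed.

(** As [p] is odd, 2 has absolute value 1, and it dominates [q ^ m - 1] in [2 + (q ^ m - 1)]. All
    denominators of the fermionic sums are therefore units. *)
Lemma abs_1DqX m : v (1 + q ^+ m) = 1.
Proof.
have abs2 : v 2%:R = 1 by apply: abs_coprime; rewrite coprimen2.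
rewrite (_ : 1 + q ^+ m = 2%:R + (q ^+ m - 1)); last by ring.
rewrite abs_dominant abs2 //.
rewrite -(subrKC 1 q) abs_exp1D_sub1 //.
apply: le_lt_trans (lt_trans qr radius_lt1).
by rewrite ler_piMl ?abs_nat_le1.
Qed.

Lemma neq0_1DqX m : 1 + q ^+ m != 0.
Proof. by rewrite -abs_gt0 abs_1DqX. Qed.

Lemma exprN_pX (a : K) N : (- a) ^+ (p ^ N) = - a ^+ (p ^ N).
Proof. by rewrite exprNn -signr_odd oddX p_odd orbT expr1 mulN1r. Qed.

Lemma qnumber_neg_pX N :
  (qnumber_neg q (p ^ N)%N)^-1 = (1 + q) / (1 + q ^+ (p ^ N)).
Proof. by rewrite /qnumber_neg exprN_pX opprK invf_div. Qed.

Lemma abs_qnumber_neg_pX N : v (qnumber_neg q (p ^ N)%N)^-1 = 1.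
Proof.
by rewrite qnumber_neg_pX vM absV abs_1DqX -{1}[q]expr1 abs_1DqX divr1.
Qed.

Lemma abs_fermionic_sum_le N f C : (forall y, v (f y) <= C) ->
  v (fermionic_sum N f) <= C.
Proof.
move=> fC; rewrite vM abs_qnumber_neg_pX mul1r.
apply: abs_sum_le => [|y _ _]; first exact: le_trans (v_ge0 _) (fC 0%N).
by rewrite vM absX absN abs_q expr1n mulr1.
Qed.

Lemma fermionic_sumB N f g :
  fermionic_sum N (fun y => f y - g y) = fermionic_sum N f - fermionic_sum N g.
Proof.
rewrite /fermionic_sum -mulrBr -sumrB; congr (_ * _).
by apply: eq_bigr => y _; rewrite mulrBl.
Qed.

Lemma fermionic_sum_sum N (I : Type) (s : seq I) (c : I -> K)
    (f : I -> nat -> K) :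
  fermionic_sum N (fun y => \sum_(i <- s) c i * f i y) =
  \sum_(i <- s) c i * fermionic_sum N (f i).
Proof.
rewrite /fermionic_sum.
under eq_bigr do rewrite mulr_suml.
rewrite exchange_big mulr_sumr; apply: eq_bigr => i _.
rewrite [RHS]mulrCA; congr (_ * _); rewrite mulr_sumr; apply: eq_bigr => y _.
by rewrite mulrA.
Qed.

Lemma has_fermionic_sum (I : Type) (s : seq I) (c : I -> K) (f : I -> nat -> K)
    (l : I -> K) :
  (forall i, has_fermionic (f i) (l i)) ->
  has_fermionic (fun y => \sum_(i <- s) c i * f i y) (\sum_(i <- s) c i * l i).
Proof.
move=> fl; rewrite /has_fermionic.
under eq_fun do rewrite fermionic_sum_sum.
by apply: vcvg_sum => i; apply/vcvgZ/fl.
Qed.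

(** The sum is geometric of ratio [- q ^ (l + 1)], and [p ^ N] is odd. The right-hand side separates
    the limit from a factor tending to 1. *)
Lemma fermionic_sum_qX l N :
  fermionic_sum N (fun y => q ^+ (l * y)) =
  (1 + q) / (1 + q ^+ l.+1) *
    ((1 + q ^+ (l.+1 * p ^ N)) / (1 + q ^+ (p ^ N))).
Proof.
rewrite /fermionic_sum qnumber_neg_pX.
have -> : \sum_(0 <= y < p ^ N) q ^+ (l * y) * (- q) ^+ y =
    (1 + q ^+ (l.+1 * p ^ N)) / (1 + q ^+ l.+1).
  apply: (mulfI (neq0_1DqX l.+1)); rewrite [RHS]mulrC divfK ?neq0_1DqX //.
  under eq_bigr do rewrite exprM -exprMn mulrN -exprSr.
  rewrite big_mkord exprM; move: (subrX1 (- q ^+ l.+1) (p ^ N)).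
  by rewrite exprN_pX; move: (q ^+ l.+1) => a geo;
    rewrite -[1 + a]opprK mulNr opprD addrC -geo opprB opprK.
by rewrite mulrACA [RHS]mulrACA; congr (_ * _); rewrite mulrC.
Qed.

Lemma has_fermionic_qX l :
  has_fermionic (fun y => q ^+ (l * y)) ((1 + q) / (1 + q ^+ l.+1)).
Proof.
apply: (vcvg_squeeze _ (fun N => pi ^+ N)).
  by apply: cvg_expr; rewrite ger0_norm ?ratio_p_lt1 // ltW // ratio_p_gt0.
move=> N; rewrite fermionic_sum_qX -{2}[_ / _]mulr1 -mulrBr.
rewrite vM vM absV abs_1DqX -{1}[q]expr1 abs_1DqX divr1 mul1r.
(* Both powers of [q] have exponents divisible by [p ^ N], so each is within [v (p ^ N)] of 1. *)
have -> : (1 + q ^+ (l.+1 * p ^ N)) / (1 + q ^+ (p ^ N)) - 1 =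
    ((q ^+ (l.+1 * p ^ N) - 1) - (q ^+ (p ^ N) - 1)) / (1 + q ^+ (p ^ N)).
  by field; rewrite neq0_1DqX.
rewrite vM absV abs_1DqX divr1.
have abs_pX : v (p ^ N)%:R = pi ^+ N by rewrite natrX absX (Cp_abs_p HK).
apply: abs_subr_le; apply: le_trans (abs_qX_sub1 _) _; rewrite -abs_pX //.
by rewrite natrM vM ler_piMl ?abs_nat_le1.
Qed.

(* The tails of the binomial series are small uniformly in the exponent, so it
   can be integrated termwise. *)
Lemma has_fermionic_pow (z : nat -> K) (c : nat -> K) t :
  (forall y, v (z y) <= 1) -> v t < r ->
  (forall n, has_fermionic (fun y => step_fact 1 (z y) n) (c n)) ->
  exists2 s, has_vsum (fun n => c n * t ^+ n / n`!%:R) s &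
    has_fermionic (fun y => padic_pow v (1 + t) (z y)) s.
Proof.
move=> z1 tr zc; have rho_ge0 := ratio_ge0 t; have rho_lt1 := ratio_lt1 _ tr.
have c_le1 n : v (c n) <= 1.
  apply: (vcvg_abs_le _ _ 0 1 _ (zc n)) => N _.
  apply: abs_fermionic_sum_le => y.
  exact: abs_step_fact_le1.
have term_le n : v (c n * t ^+ n / n`!%:R) <= (v t / r) ^+ n.
  rewrite -mulrA vM; apply: le_trans (abs_exp_divfact_le _ n tr).
  by rewrite ler_piMl.
have cs := has_vsum_geom _ _ rho_ge0 rho_lt1 term_le.
set s := vseries v _ in cs; exists s => //.
apply/vcvgP => e e_gt0; have [M Me] := geom_lt _ _ rho_ge0 rho_lt1 e_gt0.
pose P y := \sum_(0 <= n < M) t ^+ n / n`!%:R * step_fact 1 (z y) n.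
have /vcvgP/(_ e e_gt0)[N0 N0e] := has_fermionic_sum _ (index_iota 0 M)
  (fun n => t ^+ n / n`!%:R) (fun n y => step_fact 1 (z y) n) c zc.
exists N0 => N /N0e; rewrite -/P.
set S := \sum_(_ <- _) _ => PS.
have SE : S = \sum_(0 <= n < M) c n * t ^+ n / n`!%:R.
  by apply: eq_bigr => n _; rewrite mulrC mulrA.
(* Three comparisons: the power with its truncation [P], uniformly in [N]; the fermionic sum of [P]
   with its limit [S]; and [S] with the full sum [s]. *)
rewrite -(subrKA (fermionic_sum N P)); apply: abs_addr_lt.
  rewrite -fermionic_sumB; apply: le_lt_trans (Me M (leqnn M)).
  apply: abs_fermionic_sum_le => y.
  have tE : 1 + t - 1 = t by ring.
  rewrite padic_powE ?tE //.
  have -> : P y = \sum_(0 <= n < M) step_binom 1 (z y) n * t ^+ n.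
    by apply: eq_bigr => n _; rewrite /step_binom; ring.
  apply: vsum_tail_le (step_seriesP 1 (z y) t (z1 y) tr) => //.
    exact: ltW.
  by move=> n; apply: abs_step_term_le.
rewrite -(subrKA S); apply: abs_addr_lt => //.
rewrite abs_sub SE; apply: le_lt_trans (Me M (leqnn M)).
by apply: vsum_tail_le cs => //; apply: ltW.
Qed.

(** * q-Euler and q-Changhee polynomials *)

Context {x : K}.
Hypotheses (q_neq1 : q != 1) (x_le1 : v x <= 1).

(** Since [q ^ z - 1] is no larger than [q - 1], q-numbers stay in the unit disk, where the binomial
    series for (1 + t)^z is available. *)
Lemma abs_qnumber_le1 z : v z <= 1 -> v (qnumber v q z) <= 1.
Proof.
move=> z1; rewrite /qnumber vM absV ler_pdivrMr ?abs_gt0 ?subr_eq0 // mul1r.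
exact: abs_padic_pow_sub1.
Qed.

Lemma qnumberD_expE k y : qnumber v q (x + y%:R) ^+ k =
  \sum_(0 <= l < k.+1) ((1 - q) ^+ k)^-1 * 'C(k, l)%:R *
    padic_pow v q (l%:R * x) * (-1) ^+ l * q ^+ (l * y).
Proof.
rewrite /qnumber padic_powD ?abs_nat_le1 // padic_pow_nat //.
set a := padic_pow v q x; set b := q ^+ y.
have -> : (a * b - 1) / (q - 1) = (1 - q)^-1 * (- (a * b) + 1).
  by rewrite -(opprB q 1) invrN mulrC mulNr -mulrN opprD opprK.
rewrite exprMn exprVn exprD1n mulr_sumr [RHS]big_mkord; apply: eq_bigr => l _.
rewrite padic_powMn // -mulr_natr [(- (a * b)) ^+ l]exprNn exprMn -exprM.
by rewrite [(l * y)%N]mulnC; ring.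
Qed.

Lemma has_fermionic_qnumberX k :
  has_fermionic (fun y => qnumber v q (x + y%:R) ^+ k)
    (\sum_(0 <= l < k.+1) ((1 - q) ^+ k)^-1 * 'C(k, l)%:R *
      padic_pow v q (l%:R * x) * (-1) ^+ l * ((1 + q) / (1 + q ^+ l.+1))).
Proof.
under eq_fun do rewrite qnumberD_expE.
exact/has_fermionic_sum/has_fermionic_qX.
Qed.

Lemma has_fermionic_step_fact n :
  has_fermionic (fun y => step_fact 1 (qnumber v q (x + y%:R)) n)
    (\sum_(0 <= k < n.+1) (stirling1 n k)%:~R * q_Euler p v q k x).
Proof.
under eq_fun do rewrite step_fact_stirling.
apply: has_fermionic_sum => k.
by rewrite [q_Euler _ _ _ _ _](vlimE _ _ (has_fermionic_qnumberX k));
  apply: has_fermionic_qnumberX.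
Qed.

(** [q_Changhee] is a chosen coefficient sequence, so it suffices that [c] satisfies the generating
    identity and that no other sequence does. *)
Lemma q_Changhee_stirling n : q_Changhee p v q n x =
  \sum_(0 <= k < n.+1) (stirling1 n k)%:~R * q_Euler p v q k x.
Proof.
pose c n := \sum_(0 <= k < n.+1) (stirling1 n k)%:~R * q_Euler p v q k x.
have z1 y : v (qnumber v q (x + y%:R)) <= 1.
  by apply/abs_qnumber_le1/abs_addr_le; rewrite ?abs_nat_le1.
have c_gen : is_q_Changhee p v q x c.
  move=> t tr.
  have [s cs fs] := has_fermionic_pow _ c t z1 tr has_fermionic_step_fact.
  by rewrite /fermionic_integral (vlimE _ _ fs).
rewrite /q_Changhee (xget_unique _ c_gen) // => c' c'_gen.
apply/funext => m; apply/eqP; rewrite -subr_eq0.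
(* Dividing by [m!] turns the difference of two solutions into the coefficients of an ordinary power
   series vanishing on the disk. *)
rewrite -(mulIr_eq0 _ (mulIf (invr_neq0 (fact_neq0 m)))).
apply/eqP; move: m; apply: (power_series_eq0 (fun m => (c' m - c m) / m`!%:R)).
move=> t tr; have := has_vsumB _ _ _ _ (c'_gen t tr) (c_gen t tr).
by rewrite subrr; congr has_vsum; apply/funext => m; ring.
Qed.

End Fermionic.
End Cp.

Theorem theorem1 (R : realType) (p : nat) (K : fieldType) (v : K -> R)
    (q x : K) (n : nat)
    (p_prime : prime p) (p_odd : odd p) (HK : is_Cp p v)
    (q_neq1 : q <> 1) (Hq : v (1 - q) < exp_radius R p) (Hx : padic_int v x) :
  q_Changhee p v q n x =
    (1 + q) * (\sum_(0 <= k < n.+1) \sum_(0 <= l < k.+1)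
      ((1 - q) ^+ k)^-1 * 'C(k, l)%:R * padic_pow v q (l%:R * x) * (-1) ^+ l
        * ((stirling1 n k)%:~R / (1 + q ^+ l.+1)))
  /\
  (1 + q) * (\sum_(0 <= k < n.+1) \sum_(0 <= l < k.+1)
      ((1 - q) ^+ k)^-1 * 'C(k, l)%:R * padic_pow v q (l%:R * x) * (-1) ^+ l
        * ((stirling1 n k)%:~R / (1 + q ^+ l.+1))) =
    \sum_(0 <= k < n.+1) (stirling1 n k)%:~R * q_Euler p v q k x.
Proof.
have qr : v (q - 1) < exp_radius R p by rewrite (abs_sub HK).
have q1 : q != 1 by apply/eqP.
have x1 := padic_int_abs_le1 HK x Hx.
have EulerE : (1 + q) * (\sum_(0 <= k < n.+1) \sum_(0 <= l < k.+1)
      ((1 - q) ^+ k)^-1 * 'C(k, l)%:R * padic_pow v q (l%:R * x) * (-1) ^+ l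
        * ((stirling1 n k)%:~R / (1 + q ^+ l.+1))) =
    \sum_(0 <= k < n.+1) (stirling1 n k)%:~R * q_Euler p v q k x.
  rewrite mulr_sumr; apply: eq_bigr => k _.
  (* The closed form of each q-Euler polynomial gives the second equality; the first then follows
     from the Stirling expansion. *)
  rewrite [q_Euler _ _ _ _ _](vlimE HK _ _
    (has_fermionic_qnumberX p_prime HK p_odd qr x1 k)).
  by rewrite !mulr_sumr; apply: eq_bigr => l _; ring.
by split; rewrite EulerE // (q_Changhee_stirling p_prime HK).
Qed.
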